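(* Suppose that for every $\alpha>0$ we have $pn^\alpha\to\infty$ as $n\to\infty$, and that $q\ln n\to\infty$, where $q=1-p$. Then for every $d\in\mathbb{N}$ and every $\varepsilon>0$ there exists $n_0$ such that for all $n\ge n_0$, $$u_d(n,p)\ge(2-\varepsilon)\log_{\frac{1}{1-p}}(np).$$
   Context: $G(n,p)$ is the Erdős–Rényi random graph on $n$ labelled vertices (vertex set $V$), each edge present independently with probability $p=p(n)$; $\mathbb{P}_{n,p}$ is the corresponding probability and $q=1-p$. A diameter graph in $\mathbb{R}^d$ is a graph $(V,E)$ with $V\subset\mathbb{R}^d$ finite and $E=\{\{\mathbf{x},\mathbf{y}\}\subseteq V: |\mathbf{x}-\mathbf{y}|=\operatorname{diam}V\}$, where $\operatorname{diam}V=\max_{\mathbf{x},\mathbf{y}\in V}|\mathbf{x}-\mathbf{y}|$ (Euclidean norm); a graph is a diameter graph in $\mathbb{R}^d$ if it is isomorphic to one. $u_d(n,p)$ is the largest positive integer $k$ such that $\mathbb{P}_{n,p}\big(\exists W\subseteq V,\ |W|=k,\ G[W]$ is a diameter graph in $\mathbb{R}^d$ and $\chi(G[W])=d+1\big)>\frac12$, where $G[W]$ is the induced subgraph; if no such $k$ exists, $u_d(n,p)=0$. *)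

(* Defs.v *)
From Stdlib Require Import Reals ClassicalEpsilon.
From mathcomp Require Import all_boot.


Definition is_graph (n : nat) (E : {set {set 'I_n}}) : bool :=
  [forall e in E, #|e| == 2].

Definition adj (n : nat) (E : {set {set 'I_n}}) (i j : 'I_n) : bool :=
  (i != j) && ([set i; j] \in E).

Definition sqnorm_diff (d : nat) (x y : 'I_d -> R) : R :=
  \big[Rplus/R0]_(i : 'I_d) (pow (Rminus (x i) (y i)) 2).

Definition edist (d : nat) (x y : 'I_d -> R) : R := sqrt (sqnorm_diff d x y).

Local Open Scope R_scope.

Definition is_diameter_graph (n d : nat) (E : {set {set 'I_n}})
  (W : {set 'I_n}) : Prop :=
  exists f : 'I_n -> ('I_d -> R),
    (forall x y, x \in W -> y \in W -> f x = f y -> x = y) /\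
    exists D : R,
      (exists x y, x \in W /\ y \in W /\ edist d (f x) (f y) = D) /\
      (forall x y, x \in W -> y \in W -> edist d (f x) (f y) <= D) /\
      (forall x y, x \in W -> y \in W -> x <> y ->
         (adj n E x y <-> edist d (f x) (f y) = D)).

Definition colorable (n : nat) (E : {set {set 'I_n}}) (W : {set 'I_n})
  (k : nat) : Prop :=
  exists c : 'I_n -> nat,
    (forall x, x \in W -> (c x < k)%N) /\
    (forall x y, x \in W -> y \in W -> adj n E x y -> c x <> c y).

Definition chromatic_number_is (n : nat) (E : {set {set 'I_n}})
  (W : {set 'I_n}) (k : nat) : Prop :=
  colorable n E W k /\ forall j, (j < k)%N -> ~ colorable n E W j.

Definition ud_event (n d k : nat) (E : {set {set 'I_n}}) : Prop :=
  exists W : {set 'I_n}, #|W| = k /\ is_diameter_graph n d E W /\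
                         chromatic_number_is n E W d.+1.

Definition indicator (P : Prop) : R :=
  if excluded_middle_informative P then R1 else R0.

Definition prob_np (n : nat) (p : R) (P : {set {set 'I_n}} -> Prop) : R :=
  \big[Rplus/R0]_(E : {set {set 'I_n}} | is_graph n E)
     (p ^ #|E| * (1 - p) ^ ('C(n, 2) - #|E|)%N * indicator (P E)).

Local Close Scope R_scope.

Definition bool_of (P : Prop) : bool :=
  if excluded_middle_informative P then true else false.

(* u_d(n,p): the largest positive k such that
   P_{n,p}(exists k-subset W, G[W] diameter graph in R^d with chi = d+1) > 1/2,
   and 0 if there is none.  k ranges over 1..n: for k > n the event is
   impossible (probability 0 <= 1/2), so this is the same maximum. *)
Definition u_d (d n : nat) (p : R) : nat :=
  (\max_(k < n.+1 | (0 < k)%N && bool_of (Rgt (prob_np n p (ud_event n d k)) (Rinv (Rplus R1 R1))))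
     (k : nat))%N.

(* Main.v *)
(* A (d+1)-clique together with isolated vertices is a diameter graph of chromatic number
   d+1: a regular d-simplex plus points in its interior. By the second moment method, an
   induced copy of this graph H on k = (2 - eps) log_{1/q} (np) vertices exists with
   probability > 1/2. Vertex i of H is only allowed in the i-th of k disjoint blocks of
   m = n/k vertices. For two maps agreeing on l vertices, the joint probability exceeds the
   product by a factor at most p^-|H| q^-C(l,2) <= p^-|H| r^l, where r = n^(1 - eps/2)
   satisfies r^2 q^(k-1) >= 1; hence E Z^2 / (E Z)^2 <= 1 + p^-|H| ((1 + r/m)^k - 1), and
   the last term is about p^-|H| k^2 r / n = n^(- eps/2 + o(1)). *)
Require Import Defs.
From Stdlib Require Import Reals ClassicalEpsilon Lra.
From mathcomp Require Import all_boot all_order all_algebra.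
From mathcomp Require Import Rstruct.

(** * The second moment method and the binomial random graph *)

Section BinomialRandomGraph.

Import Order.TTheory GRing.Theory Num.Theory.
Local Open Scope ring_scope.
#[local] Set Implicit Arguments.
#[local] Unset Strict Implicit.
#[local] Unset Printing Implicit Defensive.

(** Chebyshev's inequality at distance [mu] from the mean: a point with [Z i = 0] has squared
    deviation [mu ^+ 2], while the whole variance is at most [delta * mu ^+ 2]. *)
Lemma second_moment_bound (R : realFieldType) (I : finType) (P : pred I)
    (w Z : I -> R) (delta : R) :
  (forall i, P i -> 0 <= w i) -> \sum_(i | P i) w i = 1 ->
  0 < \sum_(i | P i) w i * Z i ->
  \sum_(i | P i) w i * Z i ^+ 2 <=
    (1 + delta) * (\sum_(i | P i) w i * Z i) ^+ 2 ->
  1 - delta <= \sum_(i | P i && (Z i != 0)) w i.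
Proof.
move=> w_ge0 w_sum1; set mu := \sum_(i | P i) w i * Z i => mu_gt0 le_moment2.
rewrite lerBlDr -w_sum1 (bigID (fun i => Z i != 0)) /= lerD2l.
under eq_bigl do rewrite negbK.
rewrite -(ler_pM2r (exprn_gt0 2 mu_gt0)) mulr_suml.
have -> : \sum_(i | P i && (Z i == 0)) w i * mu ^+ 2 =
    \sum_(i | P i && (Z i == 0)) w i * (Z i - mu) ^+ 2.
  by apply: eq_bigr => i /andP[_ /eqP->]; rewrite sub0r sqrrN.
apply: (@le_trans _ _ (\sum_(i | P i) w i * (Z i - mu) ^+ 2)).
  rewrite [leRHS](bigID (fun i => Z i == 0)) /= lerDl.
  by apply: sumr_ge0 => i /andP[Pi _]; rewrite mulr_ge0 ?sqr_ge0 ?w_ge0.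
have -> : \sum_(i | P i) w i * (Z i - mu) ^+ 2 =
    \sum_(i | P i) w i * Z i ^+ 2 - mu ^+ 2.
  transitivity (\sum_(i | P i)
      (w i * Z i ^+ 2 - w i * Z i * (mu *+ 2) + w i * mu ^+ 2)).
    apply: eq_bigr => i _; rewrite sqrrB mulrDr mulrBr.
    by rewrite -[Z i * mu *+ 2]mulrnAr [w i * (Z i * (mu *+ 2))]mulrA.
  rewrite big_split /= sumrB -!mulr_suml w_sum1 mul1r -/mu mulrnAr -expr2.
by rewrite mulr2n opprD addrA subrK.
by rewrite lerBlDr; apply: le_trans le_moment2 _; rewrite mulrDl mul1r addrC.
Qed.

Definition gnp_weight (R : nzRingType) (n : nat) (p : R) (E : {set {set 'I_n}}) :=
  p ^+ #|E| * (1 - p) ^+ ('C(n, 2) - #|E|).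

Definition edge_slots (n : nat) := [set e : {set 'I_n} | #|e| == 2].

Lemma card_edge_slots n : #|edge_slots n| = 'C(n, 2).
Proof. by rewrite card_draws card_ord. Qed.

Lemma is_graphE n (E : {set {set 'I_n}}) : is_graph n E = (E \subset edge_slots n).
Proof.
apply/forall_inP/subsetP => h e /h; first by rewrite inE.
by rewrite inE.
Qed.

Lemma prod_if_mem (R : comNzRingType) (T : finType) (A B : {set T}) (x y : R) :
    A \subset B ->
  \prod_(e in B) (if e \in A then x else y) = x ^+ #|A| * y ^+ (#|B| - #|A|).
Proof.
move=> sAB; rewrite (bigID (mem A)) /=; congr (_ * _).
  rewrite (eq_bigr (fun=> x)) => [|e /andP[_ ->] //].
  rewrite prodr_const; congr (_ ^+ _); apply: eq_card => e.
  by rewrite unfold_in /= andbC; case: (boolP (e \in A)) => //= /(subsetP sAB).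
rewrite (eq_bigr (fun=> y)) => [|e /andP[_ /negbTE->] //].
rewrite prodr_const; congr (_ ^+ _).
have <- : #|B :\: A| = (#|B| - #|A|)%N by rewrite cardsD (setIidPr sAB).
by apply: eq_card => e; rewrite unfold_in /= !inE andbC.
Qed.

(** Distributivity turns the sum over edge sets into a product over single slots, where each slot
    outside [A :|: B] contributes a factor 1. *)
Lemma gnp_prescribed (R : idomainType) (n : nat) (p : R)
    (A B : {set {set 'I_n}}) :
    A \subset edge_slots n -> B \subset edge_slots n -> [disjoint A & B] ->
  \sum_(E | is_graph n E && ((A \subset E) && [disjoint B & E])) gnp_weight p E =
  p ^+ #|A| * (1 - p) ^+ #|B|.
Proof.
move=> sA sB dAB.
(* [F e] weighs the choice of [e] as an edge and [G e] its omission, with weight 0 for a forbidden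
   choice. Sets that are not pairs get 0 and 1, so only graphs survive the expansion. *)
pose F e : R := if e \in edge_slots n then if e \in B then 0 else p else 0.
pose G e : R := if e \in edge_slots n then if e \in A then 0 else 1 - p else 1.
transitivity (\prod_e (F e + G e)).
  rewrite bigA_distr big_mkcond; apply: eq_bigr => E _.
  rewrite is_graphE; case: ifPn => [/and3P[sE sAE dBE]|].
    rewrite (bigID (mem (edge_slots n))) /= [X in _ * X]big1 ?mulr1; last first.
      move=> e He; rewrite /F /G (negbTE He).
      by case: ifP => // /(subsetP sE); rewrite (negbTE He).
    rewrite /gnp_weight -card_edge_slots -prod_if_mem //.
    apply: eq_bigr => e He; rewrite /F /G He.
    case: ifPn => eE; first by rewrite (disjointFl dBE eE).
    by case: ifP => // /(subsetP sAE); rewrite (negbTE eE).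
  rewrite !negb_and => H; apply/esym/eqP/prodf_eq0.
  case/or3P: H => [/subsetPn[e eE eS]|/subsetPn[e eA eE]|].
  - by exists e => //; rewrite eE /F (negbTE eS) eqxx.
  - by exists e => //; rewrite (negbTE eE) /G eA (subsetP sA) ?eqxx.
  - rewrite -setI_eq0 => /set0Pn[e /setIP[eB eE]].
    by exists e => //; rewrite eE /F eB (subsetP sB) ?eqxx.
rewrite (bigID (mem (A :|: B))) /= [X in _ * X]big1 ?mulr1; last first.
  move=> e; rewrite inE negb_or => /andP[/negbTE eA /negbTE eB].
  by rewrite /F /G eA eB; case: ifP; rewrite ?add0r // addrCA subrr addr0.
rewrite (eq_bigr (fun e => if e \in A then p else 1 - p)); last first.
  move=> e; rewrite inE /F /G => /orP[eH|eH].
    by rewrite eH (disjointFr dAB eH) (subsetP sA) // addr0.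
  by rewrite eH (disjointFl dAB eH) (subsetP sB) // add0r.
rewrite prod_if_mem ?subsetUl //; congr (_ * _ ^+ _).
by rewrite cardsU (eqP (_ : A :&: B == set0)) ?setI_eq0 // cards0 subn0 addKn.
Qed.

Lemma sum_gnp_weight (R : idomainType) (n : nat) (p : R) :
  \sum_(E | is_graph n E) gnp_weight p E = 1.
Proof.
transitivity (p ^+ #|@set0 {set 'I_n}| * (1 - p) ^+ #|@set0 {set 'I_n}|).
  rewrite -gnp_prescribed ?sub0set -?setI_eq0 ?set0I //.
  by apply: eq_bigl => E; rewrite sub0set -setI_eq0 set0I eqxx !andbT.
by rewrite cards0 mulr1.
Qed.

(** * Induced copies of a fixed graph *)

Definition induced_copy (k n : nat) (H : {set {set 'I_k}}) (E : {set {set 'I_n}})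
    (g : 'I_k -> 'I_n) : bool :=
  [forall e in edge_slots k, (g @: e \in E) == (e \in H)].

(** Brings the event into the form of [gnp_prescribed]: the images of edges are prescribed present,
    those of nonedges absent. *)
Lemma induced_copyE (k n : nat) (H : {set {set 'I_k}}) (E : {set {set 'I_n}})
    (g : 'I_k -> 'I_n) : H \subset edge_slots k ->
  induced_copy H E g =
    ([set g @: e | e : {set 'I_k} in H] \subset E) &&
    [disjoint [set g @: e | e : {set 'I_k} in edge_slots k :\: H] & E].
Proof.
move=> sH; apply/forall_inP/andP => [h | [/subsetP h1 h2] e es].
  split; first by apply/subsetP=> _ /imsetP[e eH ->]; rewrite (eqP (h e _)) ?(subsetP sH).
  rewrite disjoint_subset; apply/subsetP => _ /imsetP[e /setDP[es eH] ->].
  by rewrite inE (eqP (h e es)).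
apply/eqP; case: (boolP (e \in H)) => eH; first by rewrite h1 ?imset_f.
by rewrite (disjointFr h2) // imset_f // inE eH.
Qed.

Lemma disjointU1 (T : finType) (A B C : {set T}) :
  [disjoint A :|: B & C] = [disjoint A & C] && [disjoint B & C].
Proof. by rewrite -!setI_eq0 setIUl setU_eq0. Qed.

Lemma exprD1_ge (R : realFieldType) (x : R) l : 0 <= x -> (0 < l)%N -> 1 + x ^+ l <= (1 + x) ^+ l.
Proof.
move=> x_ge0; case: l => // l _; elim: l => [|l IHl]; first by rewrite !expr1.
rewrite [leRHS]exprS; apply: le_trans (ler_wpM2l (addr_ge0 ler01 x_ge0) IHl).
rewrite mulrDl mul1r mulrDr mulr1 -exprS addrA lerD2r -addrA lerDl.
by rewrite addr_ge0 ?exprn_ge0.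
Qed.

(** A converse to Bernoulli's inequality. In the induction the cross term [x * (x *+ (2 * l))] is at
    most [x], which the factor 2 leaves room for. *)
Lemma exprD1_le (R : realFieldType) (x : R) l :
  0 <= x -> x *+ (2 * l) <= 1 -> (1 + x) ^+ l <= 1 + x *+ (2 * l).
Proof.
move=> x_ge0; elim: l => [|l IHl] le1; first by rewrite muln0 addr0.
have le1' : x *+ (2 * l) <= 1.
  by apply: le_trans le1; rewrite ler_wpMn2l // leq_mul2l leqnSn.
rewrite exprS; apply: le_trans (ler_wpM2l (addr_ge0 ler01 x_ge0) (IHl le1')) _.
rewrite mulnSr; move: (2 * l)%N le1' => j le1'.
rewrite mulrDl mul1r [x * _]mulrDr mulr1 mulrnDr -addrA !lerD2l.
by rewrite ler_piMr.
Qed.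

(* Sending vertex i into its own block {v (i, s) | s} makes the vertex pairs shared
   by two copies exactly the pairs inside the set where the two maps agree. *)
Section TransversalMaps.

Variables (k m n : nat) (v : 'I_k * 'I_m -> 'I_n).
Hypothesis v_inj : injective v.
Local Notation tmap := {ffun 'I_k -> 'I_m}.
Implicit Types (f g : tmap) (e : {set 'I_k}) (X Y : {set {set 'I_k}}).

Let tr f (i : 'I_k) : 'I_n := v (i, f i).
Let tr_edges f X : {set {set 'I_n}} := [set tr f @: e | e : {set 'I_k} in X].
Let agree f g : {set 'I_k} := [set i | f i == g i].

Lemma transversal_inj f : injective (tr f).
Proof. by move=> i j /v_inj[]. Qed.

(** Injectivity of [v] lets a vertex [v (i, s)] determine both [i] and [s], so a vertex common to
    both images has the same index in both, and the maps agree there. *)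
Lemma transversal_imset_sub f g e e' : tr f @: e \subset tr g @: e' ->
  e \subset e' :&: agree f g.
Proof.
move=> /subsetP h; apply/subsetP => i ie.
have /imsetP[j je' /v_inj[eij eq_fg]] : tr f i \in tr g @: e' by rewrite h ?imset_f.
by rewrite !inE {1}eij je' eq_fg -eij eqxx.
Qed.

Lemma transversal_imset_inj f g e e' : tr f @: e = tr g @: e' ->
  e = e' /\ e \subset agree f g.
Proof.
move=> eq_im.
have /transversal_imset_sub : tr f @: e \subset tr g @: e' by rewrite eq_im.
have /transversal_imset_sub : tr g @: e' \subset tr f @: e by rewrite eq_im.
rewrite !subsetI => /andP[s1 _] /andP[s2 s3]; split=> //.
by apply/eqP; rewrite eqEsubset s1 s2.
Qed.

Lemma card_tr_edges f X : #|tr_edges f X| = #|X|.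
Proof. by apply: card_imset => e e' /transversal_imset_inj[]. Qed.

Lemma tr_edges_sub f X : X \subset edge_slots k -> tr_edges f X \subset edge_slots n.
Proof.
move=> /subsetP sX; apply/subsetP => _ /imsetP[e /sX + ->].
by rewrite !inE card_imset //; apply: transversal_inj.
Qed.

(** With [X] the edges and [Y] the nonedges of [H], this says that two copies never make
    contradictory demands on a vertex pair. *)
Lemma tr_edges_disjoint f g X Y : [disjoint X & Y] ->
  [disjoint tr_edges f X & tr_edges g Y].
Proof.
move=> dXY; rewrite disjoint_subset; apply/subsetP => _ /imsetP[e eX ->].
rewrite inE; apply/imsetP => -[e' e'Y /transversal_imset_inj[ee' _]].
by move: e'Y; rewrite -ee' (disjointFr dXY eX).
Qed.

Lemma tr_edgesI f g X :
  tr_edges f X :&: tr_edges g X = tr_edges f [set e in X | e \subset agree f g].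
Proof.
apply/setP => E; rewrite inE; apply/andP/imsetP.
  case=> /imsetP[e eX ->] /imsetP[e' e'X /transversal_imset_inj[_ sa]].
  by exists e; rewrite // inE eX.
case=> e; rewrite inE => /andP[eX /subsetP sa] ->; rewrite imset_f //; split=> //.
apply/imsetP; exists e => //; apply: eq_in_imset => i /sa; rewrite inE => /eqP eq_i.
by rewrite /tr eq_i.
Qed.

(** Inclusion-exclusion, kept additive to avoid truncated subtraction. *)
Lemma card_tr_edgesU f g X :
  (#|tr_edges f X :|: tr_edges g X| + #|[set e in X | e \subset agree f g]| =
   #|X| + #|X|)%N.
Proof.
rewrite -(card_tr_edges f [set e in X | _]) -tr_edgesI cardsUI.
by rewrite !card_tr_edges.
Qed.

(** * First and second moments of the number of transversal copies *)

Section Moments.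

Variables (R : realFieldType) (p r : R) (H : {set {set 'I_k}}).
Hypotheses (p_gt0 : 0 < p) (p_lt1 : p < 1) (H_graph : H \subset edge_slots k).
Hypotheses (r_ge0 : 0 <= r) (r_large : 1 <= r ^+ 2 * (1 - p) ^+ k.-1).

Let nonH := edge_slots k :\: H.
Let P := p ^+ #|H| * (1 - p) ^+ #|nonH|.

Let p_ge0 : 0 <= p. Proof. exact: ltW. Qed.
Let p_le1 : p <= 1. Proof. exact: ltW. Qed.
Let q_ge0 : 0 <= 1 - p. Proof. by rewrite subr_ge0. Qed.
Let q_le1 : 1 - p <= 1. Proof. by rewrite gerBl. Qed.

Let dHn : [disjoint H & nonH].
Proof. by rewrite -setI_eq0 setIDA setDIl setDv set0I. Qed.

Let snonH : nonH \subset edge_slots k. Proof. exact: subsetDl. Qed.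

Lemma prob_transversal_copy f :
  \sum_(E | is_graph n E && induced_copy H E (tr f)) gnp_weight p E = P.
Proof.
under eq_bigl do rewrite induced_copyE //.
by rewrite gnp_prescribed ?tr_edges_sub ?tr_edges_disjoint // !card_tr_edges.
Qed.

Lemma prob_transversal_copy2 f g :
  \sum_(E | is_graph n E && (induced_copy H E (tr f) && induced_copy H E (tr g)))
     gnp_weight p E =
  p ^+ #|tr_edges f H :|: tr_edges g H| *
  (1 - p) ^+ #|tr_edges f nonH :|: tr_edges g nonH|.
Proof.
rewrite -gnp_prescribed ?subUset ?tr_edges_sub //.
  apply: eq_bigl => E; rewrite !induced_copyE // subUset disjointU1.
  by rewrite -!andbA; do !bool_congr.
rewrite disjointU1 disjoint_sym disjointU1 !tr_edges_disjoint 1?disjoint_sym //.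
by rewrite disjointU1 !tr_edges_disjoint 1?disjoint_sym.
Qed.

(** With l = [#|S|], at most C(l,2) pairs lie inside [S], and the square of q^C(l,2) r^l is (q^(l-1)
    r^2)^l, which is at least 1 since l <= k. *)
Lemma pow_r_large (X : {set {set 'I_k}}) (S : {set 'I_k}) : X \subset edge_slots k ->
  1 <= (1 - p) ^+ #|[set e in X | e \subset S]| * r ^+ #|S|.
Proof.
move=> sX; apply: (@le_trans _ _ ((1 - p) ^+ 'C(#|S|, 2) * r ^+ #|S|)); last first.
  rewrite ler_wpM2r ?exprn_ge0 // ler_wiXn2l // -cards_draws.
  apply/subset_leq_card/subsetP => e; rewrite !inE => /andP[eX ->].
  by move: (subsetP sX _ eX); rewrite inE.
have s_le_k : (#|S| <= k)%N by rewrite -[X in (_ <= X)%N]card_ord max_card.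
rewrite -(@expr_ge1 _ 2 (_ * _)) ?mulr_ge0 ?exprn_ge0 // exprMn -!exprM.
have -> : ('C(#|S|, 2) * 2 = #|S|.-1 * #|S|)%N.
  by rewrite mulnC -mul_bin_diag bin1 mulnC.
rewrite exprM [(_ * 2)%N]mulnC [r ^+ _]exprM -exprMn exprn_ege1 // mulrC.
apply: le_trans r_large _; rewrite ler_wpM2l ?exprn_ge0 // ler_wiXn2l //.
by rewrite -!subn1 leq_sub2r.
Qed.

(* Pairs of copies agreeing on l vertices gain at most the factor p^-|H| r^l, and
   r^l <= (1 + r)^l - 1 for l > 0; the latter averages to a product over vertices. *)
Lemma prob_transversal_copy2_le f g :
  p ^+ #|tr_edges f H :|: tr_edges g H| *
  (1 - p) ^+ #|tr_edges f nonH :|: tr_edges g nonH| <=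
  P ^+ 2 * (1 + p ^- #|H| * ((1 + r) ^+ #|agree f g| - 1)).
Proof.
have hH := card_tr_edgesU f g H; have hn := card_tr_edgesU f g nonH.
have pa_gt0 : 0 < p ^+ #|H| by rewrite exprn_gt0.
have P2 : P ^+ 2 = p ^+ (#|H| + #|H|) * (1 - p) ^+ (#|nonH| + #|nonH|).
  by rewrite /P exprMn -!exprM !muln2 !addnn.
(* Maps that agree nowhere share no pair, so the two events are independent and the bound is an
   equality. *)
have [S0|] := posnP #|agree f g|.
  rewrite S0 expr0 subrr mulr0 addr0 mulr1 P2 -hH -hn.
  rewrite (eqP (_ : [set e in H | e \subset agree f g] == set0)).
    rewrite (eqP (_ : [set e in nonH | e \subset agree f g] == set0)) ?cards0 ?addn0 //.
    rewrite -subset0; apply/subsetP => e; rewrite inE => /andP[/(subsetP snonH)].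
    by rewrite inE => /eqP e2 /subset_leq_card; rewrite S0 e2.
  rewrite -subset0; apply/subsetP => e; rewrite inE => /andP[/(subsetP H_graph)].
  by rewrite inE => /eqP e2 /subset_leq_card; rewrite S0 e2.
move=> S_gt0; apply: (@le_trans _ _ (P ^+ 2 * (p ^- #|H| * r ^+ #|agree f g|))).
  rewrite P2 -hH -hn !exprD.
  (* [A] and [C] belong to the unions, [B] and [D] to the shared edges and nonedges. Both
     [B / p ^+ #|H|] and [D * r ^+ #|agree f g|] are at least 1. *)
  set A := p ^+ _; set B := p ^+ _; set C := (1 - p) ^+ _; set D := (1 - p) ^+ _.
  have -> : A * B * (C * D) * (p ^- #|H| * r ^+ #|agree f g|) =
    A * C * ((B / p ^+ #|H|) * (D * r ^+ #|agree f g|)).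
    by rewrite [A * B * (C * D)]mulrACA -[LHS]mulrA [B * D * _]mulrACA.
  rewrite ler_peMr ?mulr_ge0 ?exprn_ge0 // -[leLHS]mulr1 ler_pM //.
    rewrite ler_pdivlMr // mul1r ler_wiXn2l //.
    by apply/subset_leq_card/subsetP => e; rewrite inE => /andP[].
  exact: pow_r_large.
rewrite ler_wpM2l ?exprn_ge0 ?mulr_ge0 ?exprn_ge0 //.
have pinv_ge1 : 1 <= p ^- #|H| by rewrite invf_ge1 // exprn_ile1.
apply: (@le_trans _ _ (p ^- #|H| * ((1 + r) ^+ #|agree f g| - 1))).
  by rewrite ler_wpM2l ?(le_trans ler01) // lerBrDl exprD1_ge.
by rewrite lerDr.
Qed.

(** The sum over [g] factors over the indices: at each one, the agreeing value weighs 1 + r and the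
    other m - 1 values weigh 1. *)
Lemma sum_agree f : \sum_(g : tmap) (1 + r) ^+ #|agree f g| = (m%:R + r) ^+ k.
Proof.
transitivity (\sum_(g : tmap) \prod_i (if f i == g i then 1 + r else 1)).
  apply: eq_bigr => g _; rewrite -big_mkcond /= prodr_const.
  by congr (_ ^+ _); apply: eq_card => i; rewrite !inE.
rewrite -(bigA_distr_bigA (fun i j => if f i == j then 1 + r else 1)).
rewrite -[in RHS](card_ord k) -prodr_const; apply: eq_bigr => i _.
rewrite (bigD1 (f i)) //= eqxx. rewrite addrAC; congr (_ + _).
rewrite (eq_bigr (fun=> 1)) => [|j /negbTE]; last by rewrite eq_sym => ->.
by rewrite -[in RHS](card_ord m) -sumr_const [in RHS](bigD1 (f i)).
Qed.

Lemma prob_transversal_copy_exists : r *+ (4 * k) < p ^+ #|H| *+ m ->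
  2%:R^-1 < \sum_(E | is_graph n E && [exists f : tmap, induced_copy H E (tr f)])
              gnp_weight p E.
Proof.
move=> small.
have pa_gt0 : 0 < p ^+ #|H| by rewrite exprn_gt0.
have m_gt0 : (0 < m)%N.
  case: (m) small => // /le_lt_trans; rewrite mulr0n.
  by move=> /(_ 0 (mulrn_wge0 _ r_ge0)); rewrite ltxx.
have mR_gt0 : 0 < m%:R :> R by rewrite ltr0n.
pose Z E : R := \sum_(f : tmap) (induced_copy H E (tr f))%:R.
pose N : R := m%:R ^+ k.
have N_gt0 : 0 < N by rewrite exprn_gt0.
have cardF : (#|tmap|%:R : R) = N.
  by rewrite card_ffun !card_ord natrX.
pose x := r / m%:R.
have x_ge0 : 0 <= x by rewrite divr_ge0 ?ler0n.
have P_gt0 : 0 < P by rewrite mulr_gt0 ?exprn_gt0 // subr_gt0.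
have small_x : x *+ (4 * k) < p ^+ #|H|.
  by rewrite -mulrnAl ltr_pdivrMr // mulr_natr.
(* The factor [x *+ (2 * k)] bounds (1 + x)^k - 1 by [exprD1_le]; the hypothesis [small] is exactly
   what puts [delta] below 1/2. *)
pose delta := p ^- #|H| * (x *+ (2 * k)).
have delta_lt : delta < 2%:R^-1.
  rewrite /delta mulrC ltr_pdivrMr // -ltr_pdivrMl ?invr_gt0 ?ltr0n // invrK.
  by rewrite mulr_natl -mulrnA mulnC mulnA.
have EZ : \sum_(E | is_graph n E) gnp_weight p E * Z E = N * P.
  under eq_bigr do rewrite mulr_sumr.
  rewrite exchange_big /= (eq_bigr (fun=> P)) => [|f _].
    by rewrite sumr_const -mulr_natl cardF.
  rewrite -(prob_transversal_copy f) [in RHS]big_mkcondr /=.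
  by apply: eq_bigr => E _; case: ifP => _; rewrite ?mulr1 ?mulr0.
have EZ2 : \sum_(E | is_graph n E) gnp_weight p E * Z E ^+ 2 <= (1 + delta) * (N * P) ^+ 2.
  have -> : \sum_(E | is_graph n E) gnp_weight p E * Z E ^+ 2 =
    \sum_(f : tmap) \sum_(g : tmap) \sum_(E | is_graph n E &&
        (induced_copy H E (tr f) && induced_copy H E (tr g))) gnp_weight p E.
    rewrite (eq_bigr (fun E => \sum_(f : tmap) \sum_(g : tmap)
       if induced_copy H E (tr f) && induced_copy H E (tr g) then gnp_weight p E else 0)) => [|E _].
      rewrite exchange_big /=; apply: eq_bigr => f _; rewrite exchange_big /=.
      by apply: eq_bigr => g _; rewrite [in RHS]big_mkcondr.
    rewrite expr2 /Z mulr_suml mulr_sumr; apply: eq_bigr => f _.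
    rewrite mulr_sumr mulr_sumr; apply: eq_bigr => g _.
    by do 2!case: induced_copy; rewrite ?mulr1 ?mulr0 ?mul0r.
  apply: (@le_trans _ _ (\sum_(f : tmap) \sum_(g : tmap)
      P ^+ 2 * (1 + p ^- #|H| * ((1 + r) ^+ #|agree f g| - 1)))).
    apply: ler_sum => f _; apply: ler_sum => g _.
    by rewrite prob_transversal_copy2; apply: prob_transversal_copy2_le.
  rewrite (eq_bigr (fun=> P ^+ 2 * (N + p ^- #|H| * ((m%:R + r) ^+ k - N)))) => [|f _]; last first.
    rewrite -mulr_sumr big_split /= sumr_const cardF -mulr_sumr sumrB sum_agree.
    by rewrite sumr_const cardF.
  have regroup (a b c : R) : a * (b * c) ^+ 2 = b * (c ^+ 2 * (b * a)).
    rewrite exprMn mulrC [b ^+ 2]expr2 -[b * b * _]mulrA -[LHS]mulrA.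
    by rewrite [b * c ^+ 2]mulrC -[c ^+ 2 * b * a]mulrA.
  rewrite sumr_const -[leLHS]mulr_natl cardF regroup ler_wpM2l ?(ltW N_gt0) //.
  rewrite ler_wpM2l ?exprn_ge0 ?(ltW P_gt0) //.
  rewrite [leRHS]mulrDr mulr1 lerD2l /delta [leRHS]mulrCA ler_wpM2l ?invr_ge0 ?exprn_ge0 //.
  have -> : m%:R + r = m%:R * (1 + x) by rewrite mulrDr mulr1 /x mulrCA divff ?mulr1 // gt_eqF.
  rewrite exprMn -/N -[X in _ - X]mulr1 -mulrBr ler_wpM2l ?(ltW N_gt0) // lerBlDl exprD1_le //.
  apply: le_trans (le_trans (ltW small_x) _); last by rewrite exprn_ile1.
  by rewrite ler_wpMn2l // leq_mul2r orbT.
have EZ_gt0 : 0 < \sum_(E | is_graph n E) gnp_weight p E * Z E by rewrite EZ mulr_gt0.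
rewrite -EZ in EZ2.
have w_ge0 (E : {set {set 'I_n}}) : is_graph n E -> 0 <= gnp_weight p E.
  by rewrite mulr_ge0 ?exprn_ge0.
have := second_moment_bound w_ge0 (sum_gnp_weight n p) EZ_gt0 EZ2.
rewrite (eq_bigl (fun E => is_graph n E && [exists f : tmap, induced_copy H E (tr f)])) => [|E].
  apply: lt_le_trans; rewrite ltrBrDr -ltrBrDl.
  by apply: lt_le_trans delta_lt _; rewrite lerBrDl -mulr2n -[leLHS]mulr_natr mulVf ?pnatr_eq0.
congr (_ && _); apply/idP/existsP => [ZE_neq0|[f Hf]].
  apply/existsP; apply: contraNT ZE_neq0 => /existsPn nex; rewrite /Z big1 ?eqxx // => f _.
  by rewrite (negbTE (nex f)).
rewrite /Z (bigD1 f) //= Hf; apply: lt0r_neq0.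
by rewrite ltr_pwDl // sumr_ge0.
Qed.

End Moments.
End TransversalMaps.

(** Realises the blocks by numbering the pairs (i, s) with the first k m vertices, then forgets that
    the copy is transversal. *)
Lemma prob_induced_copy (R : realFieldType) (k m n : nat) (p r : R) (H : {set {set 'I_k}}) :
    0 < p -> p < 1 -> is_graph k H -> (k * m <= n)%N ->
    0 <= r -> 1 <= r ^+ 2 * (1 - p) ^+ k.-1 -> r *+ (4 * k) < p ^+ #|H| *+ m ->
  2%:R^-1 < \sum_(E | is_graph n E &&
    [exists g : {ffun 'I_k -> 'I_n}, injectiveb g && induced_copy H E g]) gnp_weight p E.
Proof.
rewrite is_graphE => p_gt0 p_lt1 H_graph le_km_n r_ge0 r_large small.
have le_card : (#|{: 'I_k * 'I_m}| <= n)%N by rewrite card_prod !card_ord.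
pose v x := widen_ord le_card (enum_rank x).
have v_inj : injective v by move=> x y /(congr1 val)/= /val_inj/enum_rank_inj.
apply: (lt_le_trans (prob_transversal_copy_exists v_inj p_gt0 p_lt1 H_graph r_ge0 r_large small)).
rewrite big_mkcondr [leRHS]big_mkcondr /=; apply: ler_sum => E _.
have w_ge0 : 0 <= gnp_weight p E by rewrite mulr_ge0 ?exprn_ge0 ?subr_ge0 ?ltW.
case: existsP => [[f copy_f]|_]; last by case: ifP.
rewrite ifT //; apply/existsP; exists [ffun i => v (i, f i)].
have eq_tr : [ffun i => v (i, f i)] =1 (fun i => v (i, f i)) by move=> i; rewrite ffunE.
apply/andP; split.
  by apply/injectiveP => i j; rewrite !eq_tr => /v_inj[].
apply/forall_inP => e /(forall_inP copy_f)/eqP <-.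
by rewrite (eq_imset _ eq_tr).
Qed.
End BinomialRandomGraph.

(** * A regular simplex with interior points *)

Section Geometry.

Local Open Scope R_scope.

Lemma big_Rplus_const d (a : R) : \big[Rplus/R0]_(i < d) a = INR d * a.
Proof.
rewrite big_const card_ord; elim: d => [|d IHd]; first by rewrite /=; ring.
by rewrite iterS IHd S_INR; ring.
Qed.

Lemma big_Rplus_if d (j : 'I_d) (a b : R) :
  \big[Rplus/R0]_(i < d) (if i == j then a else b) = a + (INR d - 1) * b.
Proof.
case: d j => [[]//|d] j; rewrite S_INR (bigD1 j) // eqxx; congr (_ + _).
rewrite (eq_bigr (fun=> b)) => [|i /negbTE-> //].
rewrite big_const (eq_card (_ : _ =i predC1 j)) //.
rewrite cardC1 card_ord [_.-1]/=.
elim: d {j} => [|d IHd]; first by rewrite /=; ring.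
by rewrite iterS IHd S_INR -[LHS]/(b + _); ring.
Qed.

Lemma sqnorm_diffxx d (x : 'I_d -> R) : sqnorm_diff d x x = 0.
Proof.
rewrite /sqnorm_diff (eq_bigr (fun=> 0)) => [|i _]; first by rewrite big_Rplus_const; ring.
by rewrite /=; ring.
Qed.

Lemma sqnorm_diffC d (x y : 'I_d -> R) : sqnorm_diff d x y = sqnorm_diff d y x.
Proof. by apply: eq_bigr => i _; rewrite /=; ring. Qed.

(** Indices up to [d] are the simplex vertices and all later ones interior points. The family is
    infinite so that one choice serves every number of isolated vertices. *)
Lemma simplex_with_interior_points d : (1 <= d)%N ->
  exists pt : nat -> 'I_d -> R, forall i j, i <> j ->
    0 < sqnorm_diff d (pt i) (pt j) <= 2 /\
    (sqnorm_diff d (pt i) (pt j) = 2 <-> (i <= d)%N && (j <= d)%N).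
Proof.
move=> d_ge1; pose D := INR d; pose u := sqrt (D + 1).
have D_ge1 : 1 <= D by apply: (le_INR 1); apply/leP.
have uu : u * u = D + 1 by apply: sqrt_sqrt; lra.
have u_ge1 : 1 <= u by rewrite -sqrt_1; apply: sqrt_le_1_alt; lra.
have u_le : u <= 2 * D by nra.
(* The vertices e_i (i < d) and c (1, ..., 1) with d c^2 - 2 c = 1 span a regular simplex
   of side sqrt 2; the other points t (1, ..., 1), with t slightly below c, are inside. *)
pose s j : R := if j == d then 0 else / (D * INR j.+1).
pose t j := (1 + u) / D - s j.
have sE j : (d < j)%N -> 0 < s j /\ 3 * (D * s j) <= 1.
  move=> dj; rewrite /s gtn_eqF //.
  have j3 : 3 <= INR j.+1.
    have -> : 3 = INR 3 by rewrite /=; ring.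
    by apply/le_INR/leP; rewrite ltnS (leq_ltn_trans d_ge1).
  move: (INR j.+1) j3 => J J3; split; first by apply: Rinv_0_lt_compat; nra.
  have -> : D * / (D * J) = / J by field; lra.
  have := Rinv_le_contravar 3 J; lra.
have sd : s d = 0 by rewrite /s eqxx.
have s_inj i j : (d <= i < j)%N -> s i <> s j.
  case/andP=> di ij; have dj := leq_ltn_trans di ij.
  have [sj_gt0 _] := sE _ dj.
  case: (ltngtP d i) di => // [di _|<- _]; last by rewrite sd; lra.
  rewrite /s !gtn_eqF // => /Rinv_eq_reg eqDij.
  have /INR_eq[eq_ij] : INR i.+1 = INR j.+1 by apply: Rmult_eq_reg_l eqDij _; lra.
  by rewrite eq_ij ltnn in ij.
pose pt (j : nat) : 'I_d -> R :=
  fun i => if (j < d)%N then (if nat_of_ord i == j then 1 else 0) else t j.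
have dist_base i j : (i < j < d)%N -> sqnorm_diff d (pt i) (pt j) = 2.
  case/andP=> ij jd; have id_ := ltn_trans ij jd.
  have -> : sqnorm_diff d (pt i) (pt j) =
      \big[Rplus/R0]_(l < d)
        ((if l == Ordinal id_ then 1 else 0) + (if l == Ordinal jd then 1 else 0)).
    apply: eq_bigr => l _; rewrite /pt id_ jd -!val_eqE /=.
    by case: eqP => [->|_]; [rewrite ltn_eqF //|case: ifP => _]; ring.
  by rewrite big_split !big_Rplus_if /=; ring.
have dist_mixed i j : (i < d <= j)%N ->
    sqnorm_diff d (pt i) (pt j) = 2 + s j * (D * s j - 2 * u).
  case/andP=> id_ dj.
  have -> : sqnorm_diff d (pt i) (pt j) =
    \big[Rplus/R0]_(l < d) (if l == Ordinal id_ then (1 - t j) ^ 2 else (t j) ^ 2).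
    apply: eq_bigr => l _; rewrite /pt id_ ltnNge dj -!val_eqE /=.
    by case: eqP => _; rewrite /=; ring.
  rewrite big_Rplus_if -/D /t.
  (* The last summand is D c^2 - 2 c - 1 for c = (1 + u) / D, and it vanishes by [uu]. *)
  transitivity (2 + s j * (D * s j - 2 * u) + (u * u - (D + 1)) / D).
    by field; lra.
  by rewrite uu; field; lra.
have dist_axis i j : (d <= i < j)%N -> sqnorm_diff d (pt i) (pt j) = D * (s i - s j) ^ 2.
  case/andP=> di ij.
  rewrite -big_Rplus_const; apply: eq_bigr => l _.
  rewrite /pt !ltnNge di (leq_trans di (ltnW ij)) /= /t; ring.
have main i j : (i < j)%N ->
    0 < sqnorm_diff d (pt i) (pt j) <= 2 /\
    (sqnorm_diff d (pt i) (pt j) = 2 <-> (i <= d)%N && (j <= d)%N).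
  move=> ij; case: (leqP d i) => [di|id_].
    have dj := leq_ltn_trans di ij; rewrite dist_axis ?di //.
    rewrite [(j <= d)%N]leqNgt dj andbF.
    have neq : s i - s j <> 0 by have := s_inj i j; rewrite di ij => /(_ isT); lra.
    have [sj_gt0 sj_le] := sE _ dj.
    have [si_ge0 si_le] : 0 <= s i /\ 3 * (D * s i) <= 1.
      by case: (ltngtP d i) di => // [/sE[] | <-]; [lra | rewrite sd; lra].
    have sq_gt0 : 0 < (s i - s j) ^ 2 by rewrite -Rsqr_pow2; apply: Rsqr_pos_lt.
    have [w_ge w_le] : - 1 <= 3 * (D * (s i - s j)) /\ 3 * (D * (s i - s j)) <= 1.
      have := Rmult_le_pos D (s i); have := Rmult_le_pos D (s j).
      by rewrite Rmult_minus_distr_l; lra.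
    move: (s i - s j) sq_gt0 w_ge w_le {neq} => w w2_gt0 w_ge w_le.
    have Dw2_gt0 : 0 < D * w ^ 2 by apply: Rmult_lt_0_compat; lra.
    (* Two interior points: from |D w| <= 1/3 and D >= 1 follows D w^2 <= (D w)^2 <= 1/9. The two
       products make this linear. *)
    have : 0 <= (D - 1) * (D * w ^ 2) by apply: Rmult_le_pos; lra.
    have : 0 <= (1 - 3 * (D * w)) * (1 + 3 * (D * w)) by apply: Rmult_le_pos; lra.
    have -> : (1 - 3 * (D * w)) * (1 + 3 * (D * w)) =
      1 - 9 * ((D - 1) * (D * w ^ 2)) - 9 * (D * w ^ 2) by ring.
    by move=> h1 h2; split; [lra | split => //; lra].
  case: (ltngtP d j) => [dj|jd|<-].
  - rewrite dist_mixed; last by rewrite id_ (ltnW dj).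
    rewrite andbF; have [sj_gt0 sj_le] := sE _ dj.
    (* Here D s < 2 u keeps the squared distance below 2, and s u <= 2 D s <= 2/3 keeps it
       positive. *)
    have := Rmult_lt_0_compat (s j) (2 * u - D * s j).
    have := Rmult_le_pos (s j) (2 * D - u); have := Rmult_le_pos (s j) (D * s j).
    have := Rmult_le_pos D (s j).
    have -> : s j * (2 * u - D * s j) = 2 * (s j * u) - s j * (D * s j) by ring.
    have -> : s j * (2 * D - u) = 2 * (D * s j) - s j * u by ring.
    have -> : s j * (D * s j - 2 * u) = s j * (D * s j) - 2 * (s j * u) by ring.
    by move=> *; split; [lra | split => //; lra].
  - by rewrite dist_base ?ij // (ltnW id_) ; split; [lra | split].
  - rewrite dist_mixed; last by rewrite id_ leqnn.
    by rewrite sd (ltnW id_); split; [lra | split=> // _; ring].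
exists pt => i j neq_ij; case: (ltngtP i j) => [/main //|/main|//].
by rewrite sqnorm_diffC andbC.
Qed.

End Geometry.

(** * A clique with isolated vertices as a diameter graph *)

Section CliqueWithIsolatedVertices.

Definition initial_clique (k d : nat) : {set {set 'I_k}} :=
  [set e in edge_slots k | e \subset [set i : 'I_k | i <= d]].

Lemma initial_clique_graph k d : is_graph k (initial_clique k d).
Proof. by apply/forall_inP => e; rewrite !inE => /andP[]. Qed.

Lemma card_initial_clique k d : #|initial_clique k d| <= 'C(d.+1, 2).
Proof.
have -> : initial_clique k d =
    [set e : {set 'I_k} | e \subset [set i : 'I_k | i <= d] & #|e| == 2].
  by apply/setP => e; rewrite !inE andbC.
rewrite cards_draws leq_bin2l // -[leqRHS]card_ord.
rewrite -(card_in_imset (f := fun i : 'I_k => inord i : 'I_d.+1)) ?max_card //.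
move=> i j; rewrite !inE => id_ jd /(congr1 val)/=.
by rewrite !inordK // => /val_inj.
Qed.

(** Vertex [g i] is placed at [pt i], so the clique edges are exactly the pairs at distance
    [sqrt 2]. *)
Lemma ud_event_induced_copy n d k (E : {set {set 'I_n}}) (g : 'I_k -> 'I_n) :
  1 <= d -> d < k -> injective g -> induced_copy (initial_clique k d) E g ->
  ud_event n d k E.
Proof.
move=> d_ge1 d_lt_k g_inj copy_g.
have [pt pt_dist] := simplex_with_interior_points d d_ge1.
have adjE i j : adj n E (g i) (g j) = [&& i != j, i <= d & j <= d].
  rewrite /adj (inj_eq g_inj); case: (altP (i =P j)) => //= neq_ij.
  have e2 : [set i; j] \in edge_slots k by rewrite inE cards2 neq_ij.
  rewrite -imset_set1 -(imset_set1 g j) -imsetU (eqP (forall_inP copy_g _ e2)).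
  by rewrite inE e2 subUset !sub1set !inE.
(* A left inverse of [g]; the default 0 is taken only outside the image of [g]. *)
pose h x : nat := if [pick i | g i == x] is Some i then i else 0.
have gK i : h (g i) = i.
  by rewrite /h; case: pickP => [j /eqP/g_inj-> //|/(_ i)]; rewrite eqxx.
pose o0 : 'I_k := Ordinal (ltn_trans d_ge1 d_lt_k).
pose o1 : 'I_k := Ordinal (leq_ltn_trans d_ge1 d_lt_k).
have distE i j : i <> j -> (adj n E (g i) (g j) <->
    edist d (pt (h (g i))) (pt (h (g j))) = sqrt 2).
  move=> neq_ij; have neq_ij' : nat_of_ord i <> j by move/val_inj.
  rewrite adjE !gK /edist; move/eqP: (neq_ij) => -> /=.
  have [[gt0 le2] <-] := pt_dist _ _ neq_ij'.
  by split=> [-> //|/sqrt_inj ->] //; lra.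
exists [set g i | i : 'I_k]; split; first by rewrite card_imset // card_ord.
split.
  exists (fun x => pt (h x)); split.
    move=> _ _ /imsetP[i _ ->] /imsetP[j _ ->]; rewrite !gK => eq_pt.
    have [-> //|/eqP neq_ij] := altP (i =P j).
    have neq_ij' : nat_of_ord i <> j by move/val_inj.
    have [[]] := pt_dist _ _ neq_ij'; rewrite eq_pt sqnorm_diffxx; lra.
  exists (sqrt 2); split; last split.
  - exists (g o0), (g o1); rewrite !imset_f //; do 2!split=> //.
    by apply/distE => //; rewrite adjE /= d_ge1.
  - move=> _ _ /imsetP[i _ ->] /imsetP[j _ ->]; rewrite !gK /edist.
    apply: sqrt_le_1_alt; have [->|/eqP neq_ij] := altP (i =P j).
      by rewrite sqnorm_diffxx; lra.
    have neq_ij' : nat_of_ord i <> j by move/val_inj.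
    by have [[]] := pt_dist _ _ neq_ij'.
  - move=> _ _ /imsetP[i _ ->] /imsetP[j _ ->] neq_g.
    by apply: distE => eq_ij; apply: neq_g; rewrite eq_ij.
split.
  (* Clique vertices get distinct colours; the isolated ones may reuse colour 0. *)
  exists (fun x => if h x <= d then h x else 0); split=> [x _|].
    by case: ifP.
  move=> _ _ /imsetP[i _ ->] /imsetP[j _ ->]; rewrite adjE !gK.
  by case/and3P=> neq_ij -> -> eq_ij; case/eqP: neq_ij; apply: val_inj.
move=> j j_lt [c [c_lt c_proper]].
(* Pigeonhole: a proper colouring is injective on the d + 1 clique vertices. *)
pose o (i : 'I_d.+1) : 'I_k := widen_ord d_lt_k i.
have oW i : g (o i) \in [set g i | i : 'I_k] by rewrite imset_f.
pose cj (i : 'I_d.+1) : 'I_j := Ordinal (c_lt _ (oW i)).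
have : injective cj.
  move=> a b /(congr1 val)/= eq_c; apply/eqP; apply/negPn/negP => neq_ab.
  apply: (c_proper _ _ (oW a) (oW b)) eq_c.
  by rewrite adjE -val_eqE /= val_eqE neq_ab !leq_ord.
move/leq_card; rewrite !card_ord => le_dj.
by rewrite ltnNge le_dj in j_lt.
Qed.

Import Order.TTheory GRing.Theory Num.Theory.

(** Passes from a decidable event, summed algebraically, to a larger propositional event under
    [prob_np]. *)
Lemma prob_np_gt_half n (p : R) (Q : pred {set {set 'I_n}}) (A : {set {set 'I_n}} -> Prop) :
  Rle 0 p -> Rle p 1 -> (forall E, Q E -> A E) ->
  (2%:R^-1 < \sum_(E | is_graph n E && Q E) gnp_weight p E)%R ->
  Rgt (prob_np n p A) (Rinv (Rplus R1 R1)).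
Proof.
move=> /RleP p_ge0 /RleP p_le1 subQA half_lt; rewrite RinvE.
apply/RltP; apply: lt_le_trans half_lt _.
rewrite big_mkcondr /=; apply: ler_sum => E _.
have w_ge0 : (0 <= gnp_weight p E :> R)%R.
  by rewrite mulr_ge0 ?exprn_ge0 ?subr_ge0.
rewrite !RpowE -[leRHS]/(gnp_weight p E * indicator (A E))%R /indicator.
case: excluded_middle_informative => [AE|notAE].
  by rewrite mulr1; case: ifP.
by rewrite ifF ?mulr0 //; apply/negP => /subQA.
Qed.

End CliqueWithIsolatedVertices.

Local Open Scope R_scope.

(** * Reduction to numerical inequalities *)

Section Asymptotics.

Import Order.TTheory GRing.Theory Num.Theory.

(** All the probability and geometry in one criterion for fixed [n]. The bound [k <= n] places [k]
    in the range of the maximum defining [u_d]. *)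
Lemma le_u_d n d k m (p r : R) : (1 <= d)%N -> (d < k)%N -> (k <= n)%N -> (k * m <= n)%N ->
  0 < p -> p < 1 -> 0 <= r -> 1 <= r ^ 2 * (1 - p) ^ k.-1 ->
  4 * INR k * r < p ^ 'C(d.+1, 2) * INR m ->
  (k <= u_d d n p)%N.
Proof.
move=> d_ge1 d_lt_k le_kn le_kmn p_gt0 p_lt1 r_ge0 r_large small.
have k_lt : (k < n.+1)%N by [].
apply: (leq_bigmax_cond (Ordinal k_lt)).
rewrite /= (leq_ltn_trans _ d_lt_k) //= /bool_of.
case: excluded_middle_informative => // -[].
pose Q (E : {set {set 'I_n}}) := [exists g : {ffun 'I_k -> 'I_n},
  injectiveb g && induced_copy (initial_clique k d) E g].
apply: (@prob_np_gt_half _ _ Q); [lra|lra| |].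
  move=> E /existsP[g /andP[/injectiveP g_inj copy_g]].
  exact: ud_event_induced_copy copy_g.
apply: (@prob_induced_copy _ k m n p r) => //; try exact/RltP.
- exact: initial_clique_graph.
- exact/RleP.
- by move/RleP: r_large; rewrite !RpowE.
apply: lt_le_trans (_ : p ^+ 'C(d.+1, 2) *+ m <= _)%R.
  have -> : (r *+ (4 * k))%R = 4 * INR k * r.
    rewrite -mulr_natl natrM -!INRE; congr (_ * _ * _).
    by rewrite /=; ring.
  rewrite -mulr_natr -INRE -RpowE; exact/RltP.
apply: ler_wMn2r; apply: ler_wiXn2l; rewrite ?card_initial_clique //.
  by apply/RleP; apply: Rlt_le.
by apply/RleP; apply: Rlt_le.
Qed.

Lemma nat_floor (x : R) : 0 <= x -> exists k : nat, INR k <= x < INR k + 1.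
Proof.
move=> /RleP/Num.Theory.truncn_itv/andP[/RleP le_x /RltP lt_x].
by exists (Num.truncn x); rewrite -S_INR !INRE.
Qed.

Lemma ln_le_sub1 (x : R) : 0 < x -> ln x <= x - 1.
Proof.
by move=> x_gt0; have := exp_ineq1_le (ln x); rewrite exp_ln //; lra.
Qed.

Lemma ln_le (x y : R) : 0 < x -> x <= y -> ln x <= ln y.
Proof.
move=> x_gt0 [lt_xy|->]; last exact: Rle_refl.
by apply: Rlt_le; apply: ln_increasing.
Qed.

End Asymptotics.

(** * Choice of the parameters and asymptotic estimates *)

Theorem theorem24 (p : nat -> R)
  (hp : forall n : nat, 0 <= p n <= 1)
  (hpa : forall alpha : R, 0 < alpha ->
           cv_infty (fun n : nat => p n * Rpower (INR n) alpha))
  (hq : cv_infty (fun n : nat => (1 - p n) * ln (INR n))) :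
  forall d : nat, (1 <= d)%N ->
  forall eps : R, 0 < eps ->
  exists n0 : nat, forall n : nat, (n0 <= n)%N ->
    (2 - eps) * (ln (INR n * p n) / ln (1 / (1 - p n))) <= INR (u_d d n (p n)).
Proof.
move=> d d_ge1 eps eps_gt0.
(* Lowering [eps] to at most 1 only strengthens the bound, and keeps 2 - e >= 1. *)
pose e := Rmin eps 1.
have e_gt0 : 0 < e by apply: Rmin_pos; lra.
have [e_le_eps e_le1] : e <= eps /\ e <= 1 by split; [apply: Rmin_l | apply: Rmin_r].
pose a := 'C(d.+1, 2).
have d_gt0 : 1 <= INR d by apply: (le_INR 1); apply/leP.
have a_ge0 : 0 <= INR a by apply: pos_INR.
(* With M = n^alpha and r = n^(1 - e/2) this gives M^(5 + a) r <= n and alpha d <= e/2,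
   while eventually p M > 1 and k <= K M^2. *)
pose alpha := e / (2 * (5 + INR a + INR d)).
have alpha_eq : alpha * (2 * (5 + INR a + INR d)) = e by rewrite /alpha; field; lra.
have alpha_gt0 : 0 < alpha by apply: Rdiv_lt_0_compat; lra.
pose K := INR d + 4.
(* The three summands later give p s > 1, ln n <= M and 8 K^2 < M. *)
pose B := 1 + 2 / alpha + 8 * K ^ 2.
have inv_alpha_gt0 : 0 < 2 / alpha by apply: Rdiv_lt_0_compat; lra.
have K2_gt0 : 0 < K ^ 2 by apply: pow_lt; rewrite /K; lra.
have half_alpha_gt0 : 0 < alpha / 2 by lra.
have [N1 N1P] := hpa _ half_alpha_gt0 B.
have [N2 N2P] := hq 1.
exists (N1 + N2).+1 => n le_N0_n.
have /leP/N1P{N1P}big_p : (N1 <= n)%N by rewrite (leq_trans _ le_N0_n) // -addnS leq_addr.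
have /leP/N2P{N2P}big_q : (N2 <= n)%N by rewrite (leq_trans _ le_N0_n) // -addSn leq_addl.
have n_ge1 : 1 <= INR n by apply: (le_INR 1); apply/leP; apply: leq_trans le_N0_n.
have [p_ge0 p_le1] := hp n.
move: (p n) p_ge0 p_le1 big_p big_q => {N1 N2 le_N0_n hp hpa hq} {}p p_ge0 p_le1 big_p big_q.
set x := INR n in n_ge1 big_p big_q *.
(* The square root of [M]: any constant below [s] is absorbed when passing from [s] to
   [M = s * s]. *)
set s := Rpower x (alpha / 2) in big_p.
have s_gt0 : 0 < s by apply: exp_pos.
have s_gtB : B < s by nra.
have B_gt1 : 1 < B by rewrite /B; lra.
have ps_gt1 : 1 < p * s by lra.
have p_gt0 : 0 < p by nra.
pose M := Rpower x alpha.
have M_eq : M = s * s by rewrite /M /s -Rpower_plus; congr Rpower; lra.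
have M_ge_s : s <= M by rewrite M_eq; nra.
have M_gt1 : 1 < M by lra.
have ln_s : ln s = alpha / 2 * ln x by rewrite /s /Rpower ln_exp.
have ln_M : ln M = alpha * ln x by rewrite /M /Rpower ln_exp.
have ln_x_gt0 : 0 < ln x.
  have : 0 < ln s by rewrite -ln_1; apply: ln_increasing; lra.
  by rewrite ln_s => h; apply: Rmult_lt_reg_l half_alpha_gt0 _; lra.
have q_gt0 : 0 < 1 - p by apply: Rmult_lt_reg_r ln_x_gt0 _; lra.
have ln_x_le_M : ln x <= M.
  have -> : ln x = 2 / alpha * ln s by rewrite ln_s; field; lra.
  have ln_s_le := ln_le_sub1 _ s_gt0.
  apply: (Rle_trans _ (2 / alpha * s)); first by apply: Rmult_le_compat_l; lra.
  by rewrite M_eq; apply: Rmult_le_compat_r; rewrite /B in s_gtB; lra.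
have pM_gt1 : 1 < p * M by nra.
pose l := ln (1 / (1 - p)).
have l_eq : l = - ln (1 - p) by rewrite /l /Rdiv Rmult_1_l ln_Rinv.
have l_ge_p : p <= l by have := ln_le_sub1 _ q_gt0; lra.
(* From [big_q], 1/q <= ln x <= M, so l = ln (1/q) <= ln M. *)
have l_le : l <= alpha * ln x.
  rewrite -ln_M l_eq -ln_Rinv //; apply: ln_le; first exact: Rinv_0_lt_compat.
  apply: Rle_trans ln_x_le_M; apply: (Rmult_le_reg_l (1 - p)) => //.
  by rewrite Rinv_r; lra.
have M_le_x : M <= x.
  by rewrite -[X in _ <= X]Rpower_1; [apply: Rle_Rpower; nra | lra].
have xp_ge1 : 1 <= x * p by nra.
have ln_xp_ge0 : 0 <= ln (x * p) by rewrite -ln_1; apply: ln_le; lra.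
have ln_xp_le : ln (x * p) <= ln x by apply: ln_le; nra.
pose L := ln (x * p) / l.
have Ll : L * l = ln (x * p) by rewrite /L; field; lra.
have L_ge0 : 0 <= L by apply: Rle_mult_inv_pos; lra.
(* The chain is ln (x p) <= ln x <= M <= M^2 p <= M^2 l. *)
have L_le : L <= M * M.
  apply: (Rmult_le_reg_r l); first lra.
  by rewrite Ll; have := Rmult_le_compat_l (M * M) _ _ _ l_ge_p; nra.
rewrite -/l -/L.
have [k0 [k0_le k0_gt]] : exists k0, INR k0 <= (2 - e) * L < INR k0 + 1.
  by apply: nat_floor; apply: Rmult_le_pos; lra.
(* The maximum makes room for the clique, and the successor brings [k] above (2 - e) L. *)
pose k := (maxn d k0).+1.
have le_goal : (k <= u_d d n p)%N -> (2 - eps) * L <= INR (u_d d n p).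
  move=> /leP/le_INR; have /leP/le_INR : (k0.+1 <= k)%N by rewrite ltnS leq_maxr.
  by rewrite S_INR; nra.
apply: le_goal.
have MM_ge1 : 1 <= M * M by nra.
have k_le : INR k <= K * (M * M).
  rewrite /k S_INR /K; case: (leqP k0 d) => _; nra.
have k_ge1 : 1 <= INR k by rewrite /k S_INR; have := pos_INR (maxn d k0); lra.
pose r := Rpower x (1 - e / 2).
have r_ge1 : 1 <= r by rewrite -(Rpower_O x); [apply: Rle_Rpower; lra | lra].
have Ma_ge1 : 1 <= M ^ a by apply: pow_R1_Rle; lra.
have size_bound : 8 * INR k ^ 2 * r * M ^ a < x.
  (* The exponent of x is alpha (5 + a) + 1 - e/2, at most 1. Four factors [M] will cover k^2 <= K^2
     M^4, the fifth the constant 8 K^2. *)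
  have pow_le : M ^ 5 * (r * M ^ a) <= x.
    rewrite -!Rpower_pow; try lra.
    rewrite /M !Rpower_mult /r -!Rpower_plus -[X in _ <= X]Rpower_1; last lra.
    by apply: Rle_Rpower; rewrite /=; nra.
  apply: Rlt_le_trans pow_le.
  have -> : 8 * INR k ^ 2 * r * M ^ a = 8 * INR k ^ 2 * (r * M ^ a) by ring.
  apply: Rmult_lt_compat_r; first by nra.
  have : INR k ^ 2 <= (K * (M * M)) ^ 2 by apply: pow_incr; lra.
  have : 8 * K ^ 2 * (M * M) ^ 2 < M * (M * M) ^ 2.
    by apply: Rmult_lt_compat_r; [apply: pow_lt; lra | rewrite /B in s_gtB; lra].
  have -> : M ^ 5 = M * (M * M) ^ 2 by ring.
  by rewrite Rpow_mult_distr; lra.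
have k_le_x : INR k <= x.
  apply: Rlt_le; apply: Rle_lt_trans size_bound.
  have -> : 8 * INR k ^ 2 * r * M ^ a = INR k * (8 * INR k * (r * M ^ a)) by ring.
  have := Rmult_le_compat 1 r 1 (M ^ a).
  move=> rM; have {}rM : 1 <= r * M ^ a by lra.
  have := Rmult_le_compat 1 (8 * INR k) 1 (r * M ^ a).
  move=> krM; have {}krM : 1 <= 8 * INR k * (r * M ^ a) by lra.
  by have := Rmult_le_compat_l (INR k) _ _ _ krM; lra.
have le_kn : (k <= n)%N by apply/leP/INR_le.
apply: (@le_u_d n d k (n %/ k) p r) => //.
- by rewrite ltnS leq_maxl.
- by rewrite mulnC leq_trunc_div.
- lra.
- lra.
- rewrite -[k.-1]/(maxn d k0) -(Rpower_pow (maxn d k0)) // -(Rpower_pow 2); last lra.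
  rewrite /r Rpower_mult /Rpower -exp_plus -[X in X <= _]exp_0.
  have le_exp y z : y <= z -> exp y <= exp z.
    by case=> [lt_yz|->]; [apply/Rlt_le/exp_increasing | apply: Rle_refl].
  apply: le_exp.
  have -> : ln (1 - p) = - l by lra.
  (* The logarithmic form of r^2 q^(k-1) >= 1. If [d] is the maximum, use d l <= d alpha ln x;
     otherwise k0 l <= (2 - e) L l = (2 - e) ln (x p). *)
  have : INR (maxn d k0) * l <= (2 - e) * ln x.
    case: (leqP k0 d) => _.
      apply: Rle_trans (Rmult_le_compat_l _ _ _ _ l_le) _; first lra.
      rewrite -Rmult_assoc; apply: Rmult_le_compat_r; nra.
    apply: (Rle_trans _ ((2 - e) * L * l)); first by apply: Rmult_le_compat_r; lra.
    by rewrite Rmult_assoc Ll; apply: Rmult_le_compat_l; lra.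
  by rewrite /=; lra.
- set m := n %/ k.
  have m_ge1 : 1 <= INR m by apply: (le_INR 1); apply/leP; rewrite divn_gt0.
  have x_lt : x < INR k * (INR m + 1).
    rewrite -S_INR -mult_INR; apply: lt_INR; apply/ltP.
    by rewrite multE mulnC ltn_ceil.
  have pMa_ge1 : 1 <= p ^ a * M ^ a by rewrite -Rpow_mult_distr; apply: pow_R1_Rle; lra.
  (* This factor turns the left side into that of [size_bound], and the right side into 2 k m (p
     M)^a >= 2 k m >= k (m + 1) > x. *)
  apply: (Rmult_lt_reg_r (2 * INR k * M ^ a)); first by apply: Rmult_lt_0_compat; lra.
  have -> : 4 * INR k * r * (2 * INR k * M ^ a) = 8 * INR k ^ 2 * r * M ^ a by ring.
  apply: Rlt_le_trans size_bound _.
  have -> : p ^ a * INR m * (2 * INR k * M ^ a) = 2 * (INR k * INR m) * (p ^ a * M ^ a) by ring.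
  apply: (Rle_trans _ (2 * (INR k * INR m) * 1)); first by nra.
  apply: Rmult_le_compat_l => //; nra.
Qed.
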